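(* Let $H$ be a complex (respectively, real) Hilbert space and $n$ a positive integer such that $2n < \dim H$. Let $\phi : P_n(H)\to P_n(H)$ be a surjective map which preserves orthogonality in both directions, i.e. for all $P,Q\in P_n(H)$, $$PQ=0 \iff \phi(P)\phi(Q)=0.$$ Then there exists a unitary or antiunitary operator (respectively, in the real case, an orthogonal operator) $U$ on $H$ such that $$\phi(P)=UPU^\ast \qquad (P\in P_n(H)).$$
   Context: $P_n(H)$ denotes the set of all rank-$n$ orthogonal projections on $H$ (bounded self-adjoint idempotents with $n$-dimensional range). $H$ may be finite or infinite dimensional. Two projections $P,Q$ are called orthogonal if $PQ=0$ (equivalently $QP=0$, equivalently their ranges are orthogonal). An antiunitary operator on a complex Hilbert space is a bijective conjugate-linear isometry, with adjoint (equal to its inverse) denoted by $U^\ast$; an orthogonal operator on a real Hilbert space is a bijective linear isometry. *)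

(* Defs.v *)
From HB Require Import structures.
From mathcomp Require Import all_boot all_order all_algebra.
From mathcomp Require Import complex.
From mathcomp Require Import all_classical all_reals all_analysis.

Set Implicit Arguments.
Unset Strict Implicit.
Unset Printing Implicit Defensive.

Import Order.TTheory GRing.Theory Num.Theory.
Import numFieldNormedType.Exports.

Local Open Scope classical_set_scope.
Local Open Scope ring_scope.

(* A Hilbert space over K is a complete normed space H together with an inner
   product ip : {dot H for theta} (linear in the first argument, theta-linear
   in the second, positive definite) such that norm_from_dot ip. Here K is R
   with theta the identity, or R[i] with theta the complex conjugation. *)
Section Hilbert.
Variables (K : numFieldType) (theta : K -> K) (H : completeNormedModType K).
Variable ip : {dot H for theta}.

Definition norm_from_dot : Prop := forall x : H, `|x| ^+ 2 = ip x x.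

Definition lin_indep (d : nat) (b : 'I_d -> H) : Prop :=
  forall c : 'I_d -> K, \sum_i c i *: b i = 0 -> forall i, c i = 0.

Definition lin_span (d : nat) (b : 'I_d -> H) : set H :=
  [set x | exists c : 'I_d -> K, x = \sum_i c i *: b i].

(* A is a linear subspace of finite dimension d; an infinite-dimensional
   subspace has no such d. *)
Definition fin_dim (A : set H) (d : nat) : Prop :=
  exists b : 'I_d -> H, lin_indep b /\ A = lin_span b.

(* m < dim H, where dim H may be infinite *)
Definition dim_gt (m : nat) : Prop :=
  forall d, fin_dim [set: H] d -> (m < d)%N.

Definition bounded_op (A : H -> H) : Prop :=
  exists M : K, forall x, `|A x| <= M * `|x|.

Definition self_adjoint (A : H -> H) : Prop :=
  forall x y, ip (A x) y = ip x (A y).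

(* P_n(H) *)
Definition rank_proj (n : nat) : set (H -> H) :=
  [set P | [/\ linear P, bounded_op P, self_adjoint P,
               idempotent_fun P & fin_dim (range P) n]].

Definition proj_orthogonal (n : nat) (P Q : rank_proj n) : Prop :=
  val P \o val Q = cst 0.

Definition preserves_orthogonality (n : nat) (phi : rank_proj n -> rank_proj n)
  : Prop :=
  forall P Q, proj_orthogonal P Q <-> proj_orthogonal (phi P) (phi Q).

(* For K = R this is an orthogonal operator. *)
Definition unitary_op (U : H -> H) : Prop :=
  [/\ linear U, bijective U & forall x, `|U x| = `|x|].

Definition adjoint_op (U V : H -> H) : Prop :=
  forall x y, ip (U x) y = ip x (V y).

Definition antiunitary_op (U : H -> H) : Prop :=
  [/\ GRing.linear_for (theta \; *:%R) U, bijective U & forall x, `|U x| = `|x|].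

Definition antiadjoint_op (U V : H -> H) : Prop :=
  forall x y, ip (U x) y = theta (ip x (V y)).

End Hilbert.

(* Main.v *)
Require Import Defs.
From HB Require Import structures.
From mathcomp Require Import all_boot all_order all_algebra.
From mathcomp Require Import complex.
From mathcomp Require Import all_classical all_reals all_analysis.
From mathcomp Require Import zify.
Import Order.TTheory GRing.Theory Num.Theory.
Import numFieldNormedType.Exports.
Local Open Scope classical_set_scope.
Local Open Scope ring_scope.

Set Implicit Arguments.
Unset Strict Implicit.
Unset Printing Implicit Defensive.

(** Let G_n be the set of n-dimensional subspaces of H; a rank n projection
   is the same thing as its range, and orthogonality of projections is
   orthogonality of ranges.  So phi becomes an orthogonality preserving
   bijection f of G_n (it is injective because P is recovered from the set of
   all Q orthogonal to it), and its inverse g preserves orthogonality too: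
   this is the notion ortho_iso.  Everything rests on the fact that
   orthogonality determines inclusion: if k + n <= 2n + 1, a subspace P lies
   in a k-dimensional W as soon as every Q in G_n orthogonal to W is
   orthogonal to P (sub_of_orth).

   Descent from n + 1 to n.  As 2(n + 1) < dim H, the fact above applies to
   W of dimension n + 2 and shows that f maps the P in G_(n+1) lying in a
   given W into a single W' (ortho_iso_superspace).  Hence f preserves
   adjacency, which means to share an n-dimensional subspace.  As in
   Chow's theorem, a family of pairwise adjacent subspaces either has a
   common n-dimensional subspace or lies in an (n+2)-dimensional one
   (triple_meet); since f and g preserve the families of the second kind, they
   preserve the stars, the sets of all P containing a given V in G_n
   (ortho_iso_star).  So f induces a map f' on G_n with V <= P iff
   f' V <= f P; it is again an ortho_iso (ortho_iso_descent), and an operator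
   that implements f' implements f, because P is the union of its hyperplanes
   as soon as n > 0.

   The case n = 1 (Uhlhorn's theorem).  Fix unit vectors e and e' with
   f<e> = <e'>.  A line not orthogonal to e is <e + x> for a unique x
   orthogonal to e, and f<e + x> = <e' + G x> defines a bijection G from the
   orthogonal complement of e to that of e'.  Since f preserves collinearity,
   f<x> = <G x>; intersecting the planes spanned by <e + x>, <y> and by
   <e + y>, <x> gives additivity of G when x and y are independent, and dim H > 2
   gives it always.  So G is semilinear for a ring endomorphism sigma of the
   scalars.  Now e + x and e + y are orthogonal exactly when <x, y> = -1; so
   <x, y> = -1 implies <G x, G y> = -1, and rescaling x yields
   <G x, G y> = sigma <x, y> (chart_map_ip).  Then
   U v = sigma <v, e> e' + G (v - <v, e> e) is the operator sought.

   Applied to multiples of a unit vector, chart_map_ip also shows that sigma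
   commutes with the conjugation of the scalars.  An endomorphism of the real
   field is the identity because it is monotone and fixes the rationals; so over
   the complex field sigma fixes the reals and is the identity or the
   conjugation.  Thus U is unitary or antiunitary (orthogonal in the real case),
   and U P U^* is the projection with range U (range P), hence equal to
   phi P. *)

(** * Subspaces of finite dimension *)

Section FiniteDimension.
Context {K : numFieldType} {H : completeNormedModType K}.
Implicit Types (A B C W : set H) (d e m : nat).

Definition subspace A : Prop :=
  A 0 /\ forall t x y, A x -> A y -> A (t *: x + y).

Definition line (v : H) : set H := [set t *: v | t in [set: K]].

Definition adjoin A (v : H) : set H :=
  [set x | exists a t, A a /\ x = a + t *: v].

Lemma subspaceZ A t x : subspace A -> A x -> A (t *: x).
Proof. by case=> A0 sA Ax; rewrite -[_ *: _]addr0; apply: sA. Qed.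

Lemma subspaceD A x y : subspace A -> A x -> A y -> A (x + y).
Proof. by case=> A0 sA Ax Ay; rewrite -[x]scale1r; apply: sA. Qed.

Lemma subspaceN A x : subspace A -> A x -> A (- x).
Proof. by move=> sA Ax; rewrite -scaleN1r; apply: subspaceZ. Qed.

Lemma subspaceB A x y : subspace A -> A x -> A y -> A (x - y).
Proof. by move=> sA Ax Ay; apply: subspaceD => //; apply: subspaceN. Qed.

Lemma subspace_sum A d (c : 'I_d -> K) (b : 'I_d -> H) :
  subspace A -> (forall i, A (b i)) -> A (\sum_i c i *: b i).
Proof.
move=> sA Ab; elim/big_ind: _ => [|x y|i _]; first by case: sA.
- exact: subspaceD.
- exact: subspaceZ.
Qed.

Lemma fin_dim_subspace A d : fin_dim A d -> subspace A.
Proof.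
case=> b [_ ->]; split.
  by exists (fun=> 0); rewrite big1 // => i _; rewrite scale0r.
move=> t x y [c ->] [c' ->]; exists (fun i => t * c i + c' i).
rewrite scaler_sumr -big_split; apply: eq_bigr => i _ /=.
by rewrite scalerDl scalerA.
Qed.

Lemma lin_span_basis d (b : 'I_d -> H) i : lin_span b (b i).
Proof.
exists (fun j => (j == i)%:R).
rewrite (bigD1 i) //= eqxx scale1r big1 ?addr0 // => j /negbTE ->.
by rewrite scale0r.
Qed.

Lemma fin_dim0 A : fin_dim A 0 <-> A = [set 0].
Proof.
split=> [[b [_ ->]]|->].
  apply/seteqP; split=> x /=; first by case=> c ->; rewrite big_ord0.
  by move=> ->; exists (fun=> 0); rewrite big_ord0.
exists (fun=> 0); split; first by move=> c _ [].
apply/seteqP; split=> x /=; last by case=> c ->; rewrite big_ord0.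
by move=> ->; exists (fun=> 0); rewrite big_ord0.
Qed.

Lemma sub_adjoin A v : A `<=` adjoin A v.
Proof. by move=> x Ax; exists x, 0; rewrite scale0r addr0. Qed.

Lemma mem_adjoin A v : subspace A -> adjoin A v v.
Proof. by case=> A0 _; exists 0, 1; rewrite scale1r add0r. Qed.

Lemma adjoin_sub A B v : subspace B -> A `<=` B -> B v -> adjoin A v `<=` B.
Proof.
move=> sB AB Bv x [a [t [Aa ->]]].
by apply: subspaceD => //; [apply: AB | apply: subspaceZ].
Qed.

Lemma subspace_adjoin A v : subspace A -> subspace (adjoin A v).
Proof.
move=> sA; split; first by apply: sub_adjoin; case: sA.
move=> t x y [a [s [Aa ->]]] [b [r [Ab ->]]].
exists (t *: a + b), (t * s + r); split; first by case: sA => _; apply.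
by rewrite scalerDr scalerDl scalerA addrACA.
Qed.

(** A relation in which [v] has a nonzero coefficient would put [v] in [A]. *)
Lemma fin_dim_adjoin A d v : fin_dim A d -> ~ A v -> fin_dim (adjoin A v) d.+1.
Proof.
move=> /[dup] /fin_dim_subspace sA [b [bfree Ab]] nAv.
exists (fun i => if unlift ord0 i is Some j then b j else v); split.
  move=> c; rewrite big_ord_recl unlift_none.
  under eq_bigr do rewrite liftK.
  move=> c0; have c00 : c ord0 = 0.
    apply/eqP/negP => /negP nz; apply: nAv; rewrite -[v](scalerK nz).
    apply: subspaceZ => //; move/eqP: c0; rewrite addr_eq0 => /eqP ->.
    apply: subspaceN => //; apply: subspace_sum => // i.
    by rewrite Ab; apply: lin_span_basis.
  move: c0; rewrite c00 scale0r add0r => /bfree c0 i.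
  by case: (unliftP ord0 i) => [j|] ->.
apply/seteqP; split=> x.
  case=> a [t []]; rewrite Ab => -[c ->] ->.
  exists (fun i => if unlift ord0 i is Some j then c j else t).
  rewrite big_ord_recl unlift_none addrC; congr (_ + _).
  by apply: eq_bigr => i _; rewrite liftK.
case=> c ->; rewrite big_ord_recl unlift_none.
under eq_bigr do rewrite liftK.
exists (\sum_i c (lift ord0 i) *: b i), (c ord0); split; last exact: addrC.
by rewrite Ab; eexists.
Qed.

Lemma fin_dimS_adjoin A d : fin_dim A d.+1 ->
  exists B v, [/\ fin_dim B d, ~ B v & A = adjoin B v].
Proof.
case=> b [bfree ->]; pose b' i := b (lift ord0 i).
exists (lin_span b'), (b ord0); split.
- exists b'; split=> // c c0 i.
  pose c' i := if unlift ord0 i is Some j then c j else 0.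
  have : \sum_i c' i *: b i = 0.
    rewrite big_ord_recl /c' unlift_none scale0r add0r -[RHS]c0.
    by apply: eq_bigr => j _; rewrite liftK.
  by move=> /bfree /(_ (lift ord0 i)); rewrite /c' liftK.
- case=> c bE.
  pose c' i := if unlift ord0 i is Some j then c j else -1.
  have : \sum_i c' i *: b i = 0.
    rewrite big_ord_recl /c' unlift_none scaleN1r bE addrC.
    by apply/eqP; rewrite subr_eq0; apply/eqP/eq_bigr => j _; rewrite liftK.
  move=> /bfree /(_ ord0) /eqP; rewrite /c' unlift_none.
  by rewrite oppr_eq0 oner_eq0.
- apply/seteqP; split=> x.
    case=> c ->; rewrite big_ord_recl addrC.
    by eexists; eexists; split; last reflexivity; eexists.
  case=> a [t [[c ->] ->]].
  exists (fun i => if unlift ord0 i is Some j then c j else t).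
  rewrite big_ord_recl unlift_none addrC; congr (_ + _).
  by apply: eq_bigr => i _; rewrite liftK.
Qed.

(** The Steinitz bound.  If [d > e], the [d x e] matrix of coordinates of the
   [a i] has a nonzero row in its left kernel, and this row is a linear relation
   between the [a i]. *)
Lemma lin_indep_leq d e (a : 'I_d -> H) (b : 'I_e -> H) :
  lin_indep a -> (forall i, lin_span b (a i)) -> (d <= e)%N.
Proof.
move=> afree /choice[M aE]; rewrite leqNgt; apply/negP => ltde.
pose N := (\matrix_(i < d, j < e) M i j)%R.
have /rowV0Pn[u /sub_kermxP uN /eqP unz] : kermx N != 0.
  by rewrite kermx_eq0 /row_free neq_ltn (leq_ltn_trans (rank_leq_col _)).
apply: unz; apply/rowP => i; rewrite mxE.
apply: afree (fun i => u 0 i) _ i.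
under eq_bigr do rewrite aE scaler_sumr.
rewrite exchange_big big1 //= => j _.
under eq_bigr do rewrite scalerA.
rewrite -scaler_suml; suff -> : \sum_i u 0 i * M i j = 0 by rewrite scale0r.
move: (congr1 (fun A : 'rV_e => A 0 j) uN); rewrite !mxE => {2}<-.
by apply: eq_bigr => l _; rewrite [N _ _]mxE.
Qed.

Lemma fin_dim_leq A B d e : fin_dim A d -> fin_dim B e -> A `<=` B -> (d <= e)%N.
Proof.
move=> [a [afree Aa]] [b [_ Bb]] AB; apply: (@lin_indep_leq _ _ a b afree) => i.
by rewrite -Bb; apply: AB; rewrite Aa; apply: lin_span_basis.
Qed.

Lemma fin_dim_sub_eq A B d : fin_dim A d -> fin_dim B d -> A `<=` B -> A = B.
Proof.
move=> dA dB AB; apply/seteqP; split=> // x Bx; apply: contrapT => nAx.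
have /fin_dim_leq/(_ dB) := fin_dim_adjoin dA nAx.
have /[swap]/[apply] : adjoin A x `<=` B.
  by apply: adjoin_sub => //; apply: fin_dim_subspace dB.
by rewrite ltnn.
Qed.

Lemma adjoin_eq A B d x : fin_dim A d -> fin_dim B d.+1 -> A `<=` B -> B x ->
  ~ A x -> B = adjoin A x.
Proof.
move=> dA dB AB Bx nAx; apply/esym/(@fin_dim_sub_eq _ _ d.+1) => //.
  exact: fin_dim_adjoin.
by apply: adjoin_sub => //; apply: fin_dim_subspace dB.
Qed.

Lemma fin_dim_neqP A B d : fin_dim A d -> fin_dim B d -> A <> B ->
  exists2 x, B x & ~ A x.
Proof.
move=> dA dB nAB; apply: contrapT => nex; apply: nAB.
apply/esym/(@fin_dim_sub_eq _ _ d) => // x Bx; apply: contrapT => nAx.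
by apply: nex; exists x.
Qed.

(** Adjoining vectors of [B] one at a time must stop after at most [d] steps,
   and it stops only when [B] is reached. *)
Lemma subspace_fin_dim A B d : fin_dim A d -> subspace B -> B `<=` A ->
  exists2 e, (e <= d)%N & fin_dim B e.
Proof.
move=> dA sB BA.
(* After k steps, either B has been reached or C is k-dimensional in B. *)
suff /(_ d) [//|[C [dC CB]]] : forall k, (exists2 e, (e <= d)%N & fin_dim B e)
    \/ exists C, fin_dim C k /\ C `<=` B.
  exists d => //; suff <- : C = B by [].
  apply/seteqP; split=> // x /BA; suff <- : C = A by [].
  by apply: fin_dim_sub_eq dC dA _ => y /CB/BA.
elim=> [|k [|[C [dC CB]]]]; [right| by left |].
  exists [set 0]; split; first exact/fin_dim0.
  by move=> x ->; case: sB.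
have [BC|nBC] := pselect (B `<=` C).
  left; exists k; last by have -> : B = C by apply/seteqP.
  by apply: fin_dim_leq dC dA _ => y /CB/BA.
right; have /existsNP[x /not_implyP[Bx nCx]] := nBC.
exists (adjoin C x); split; first exact: fin_dim_adjoin.
exact: adjoin_sub.
Qed.

Lemma fin_dim_join A B d e : fin_dim A d -> fin_dim B e ->
  exists C k, [/\ (k <= d + e)%N, fin_dim C k, A `<=` C & B `<=` C].
Proof.
move=> dA; elim: e B => [|e IH] B.
  move=> /fin_dim0 ->; exists A, d; split=> //; first by rewrite addn0.
  by move=> x ->; case: (fin_dim_subspace dA).
move=> /fin_dimS_adjoin[B' [v [/IH[C [k [lek dC AC BC]]] _ ->]]].
have sC := fin_dim_subspace dC.
have [Cv|nCv] := pselect (C v).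
  exists C, k; split=> //; first by rewrite addnS ltnW.
  exact: adjoin_sub.
exists (adjoin C v), k.+1; split.
- by rewrite addnS.
- exact: fin_dim_adjoin.
- by move=> x /AC; apply: sub_adjoin.
- apply: adjoin_sub; first exact: subspace_adjoin.
    by move=> x /BC; apply: sub_adjoin.
  exact: mem_adjoin.
Qed.

Lemma hyperplane A d : fin_dim A d.+1 -> exists2 B, fin_dim B d & B `<=` A.
Proof.
by case/fin_dimS_adjoin=> B [v [dB _ ->]]; exists B => //; apply: sub_adjoin.
Qed.

(** The dimension is at least 2 here: in a line, the only hyperplane is 0.  This
   is why the descent on ranks stops at rank 1. *)
Lemma hyperplane_through A d x : fin_dim A d.+2 -> A x ->
  exists B, [/\ fin_dim B d.+1, B x & B `<=` A].
Proof.
move=> dA Ax; have [B dB BA] := hyperplane dA.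
have [Bx|nBx] := pselect (B x); first by exists B.
have [C dC CB] := hyperplane dB.
exists (adjoin C x); split.
- by apply: fin_dim_adjoin => // /CB.
- exact/mem_adjoin/(fin_dim_subspace dC).
- by apply: adjoin_sub; [exact: fin_dim_subspace dA|move=> y /CB/BA|].
Qed.

Lemma mem_line v : line v v. Proof. by exists 1 => //; rewrite scale1r. Qed.

Lemma adjoin0 v : adjoin [set 0] v = line v.
Proof.
apply/seteqP; split=> x.
  by case=> a [t [-> ->]]; exists t; rewrite ?add0r.
by case=> t _ <-; exists 0, t; rewrite add0r.
Qed.

Lemma fin_dim_line v : v != 0 -> fin_dim (line v) 1.
Proof.
move=> /eqP nz; rewrite -adjoin0.
by apply: fin_dim_adjoin; first exact/fin_dim0.
Qed.

Lemma fin_dim1 A : fin_dim A 1 -> exists2 v, v != 0 & A = line v.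
Proof.
case/fin_dimS_adjoin=> B [v [/fin_dim0 -> /eqP nz ->]].
by exists v; rewrite ?adjoin0.
Qed.

End FiniteDimension.

(** * Orthogonality of subspaces *)

Section Orthogonality.
Context {K : numFieldType} {theta : {rmorphism K -> K}}.
Context {H : completeNormedModType K}.
Variable ip : {dot H for theta}.
Implicit Types (A B C W : set H) (x y z : H) (d e k m : nat).

Lemma ipDl x y z : ip (x + y) z = ip x z + ip y z. Proof. exact: linearDl. Qed.
Lemma ipDr x y z : ip x (y + z) = ip x y + ip x z. Proof. exact: linearDr. Qed.
Lemma ipBl x y z : ip (x - y) z = ip x z - ip y z. Proof. exact: linearBl. Qed.
Lemma ipBr x y z : ip x (y - z) = ip x y - ip x z. Proof. exact: linearBr. Qed.
Lemma ip0l x : ip 0 x = 0. Proof. exact: linear0l. Qed.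
Lemma ip0r x : ip x 0 = 0. Proof. exact: linear0r. Qed.
Lemma ipZl t x y : ip (t *: x) y = t * ip x y. Proof. exact: linearZl_LR. Qed.
Lemma ipZr t x y : ip x (t *: y) = theta t * ip x y.
Proof. exact: linearZr_LR. Qed.
Lemma ipC x y : ip x y = theta (ip y x).
Proof. by rewrite (hermitian_subproof x y) expr0 mul1r. Qed.

Lemma ip_eq0 x : (ip x x == 0) = (x == 0).
Proof.
apply/idP/eqP => [|->]; last by rewrite ip0l eqxx.
by apply: contraTeq => /neq0_dnorm_gt0 -/(_ _ ip); apply: lt0r_neq0.
Qed.

Lemma ip0C x y : ip x y = 0 -> ip y x = 0.
Proof. by move=> xy; rewrite ipC xy rmorph0. Qed.

Definition orth A B : Prop := forall x y, A x -> B y -> ip x y = 0.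

Lemma orthC A B : orth A B -> orth B A.
Proof. by move=> AB x y Bx Ay; apply/ip0C/AB. Qed.

Lemma orth_sub A A' B B' : A' `<=` A -> B' `<=` B -> orth A B -> orth A' B'.
Proof. by move=> sA sB AB x y /sA Ax /sB By; apply: AB. Qed.

Lemma orth_adjoin A B v : orth A B -> (forall x, A x -> ip x v = 0) ->
  orth A (adjoin B v).
Proof.
move=> AB Av x y Ax [b [t [Bb ->]]].
by rewrite ipDr ipZr AB // Av // mulr0 addr0.
Qed.

Lemma orth_lines x y : orth (line x) (line y) <-> ip x y = 0.
Proof.
split=> [|xy _ _ [t _ <-] [s _ <-]]; first by apply; apply: mem_line.
by rewrite ipZl ipZr xy !mulr0.
Qed.

(** One Gram-Schmidt step: writing [v = b + w] with [w] orthogonal to [B], the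
   component of [x] along [w] is added to its projection on [B]. *)
Lemma orthogonal_projection A d : fin_dim A d ->
  forall x, exists2 a, A a & forall y, A y -> ip (x - a) y = 0.
Proof.
elim: d A => [|d IH] A.
  by move=> /fin_dim0 -> x; exists 0 => // y ->; rewrite ip0r.
case/fin_dimS_adjoin=> B [v [dB nBv ->]] x.
have [b Bb vb] := IH _ dB v; have [a Ba xa] := IH _ dB x.
have sB := fin_dim_subspace dB.
pose w := v - b; have w0 : ip w w != 0.
  rewrite ip_eq0 subr_eq0; apply/eqP => vE.
  by apply: nBv; rewrite vE.
have wB y : B y -> ip y w = 0 by move=> /vb; apply: ip0C.
have [t tE] : exists t, ip (x - a) w = t * ip w w.
  by exists (ip (x - a) w / ip w w); rewrite divfK.
exists (a + t *: w).
  apply: (subspaceD (subspace_adjoin _ sB)); first exact: sub_adjoin.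
  apply: (subspaceZ _ (subspace_adjoin _ sB)).
  apply: (subspaceB (subspace_adjoin _ sB)); last exact: sub_adjoin.
  exact: mem_adjoin.
move=> _ [c [s [Bc ->]]]; have -> : c + s *: v = (c + s *: b) + s *: w.
  by rewrite -addrA -scalerDr [b + _]addrC subrK.
have Bcb : B (c + s *: b) by apply: subspaceD => //; apply: subspaceZ.
rewrite opprD addrA ipDr ipZr ![ip (_ - t *: w) _]ipBl xa // tE !ipZl.
by rewrite [ip w _]vb // mulr0 !subrr mulr0 addr0.
Qed.

Section LargeDimension.
Variable m : nat.
Hypothesis dim_m : dim_gt H m.

Lemma dim_gt_notin A d : fin_dim A d -> (d <= m)%N -> exists x, ~ A x.
Proof.
move=> dA ledm; apply: contrapT => nex.
have AT : A = setT.
  by apply/seteqP; split=> // x _; apply: contrapT => nAx; apply: nex; exists x.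
by move: dA; rewrite AT => /dim_m; rewrite ltnNge ledm.
Qed.

Lemma dim_gt_orth A d : fin_dim A d -> (d <= m)%N ->
  exists2 z, z != 0 & forall y, A y -> ip z y = 0.
Proof.
move=> dA /(dim_gt_notin dA)[x nAx].
have [a Aa xa] := orthogonal_projection dA x; exists (x - a) => //.
by rewrite subr_eq0; apply/eqP => xE; apply: nAx; rewrite xE.
Qed.

(** In a space of dimension greater than [m] there is room for [B] and [A] to
   be orthogonal with [B] enlarged, as long as the dimensions involved add up to
   at most [m + 1]. *)
Lemma fin_dim_extend_orth A B d e k : fin_dim A d -> fin_dim B e ->
  orth B A -> (d + e + k <= m.+1)%N ->
  exists C, [/\ fin_dim C (e + k), B `<=` C & orth C A].
Proof.
move=> dA dB oBA; elim: k => [|k IH] lek.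
  by exists B; split; rewrite ?addn0.
have [|C [dC BC oCA]] := IH; first lia.
have [D [l [lel dD AD CD]]] := fin_dim_join dA dC.
have [|z znz zD] := dim_gt_orth dD; first lia.
exists (adjoin C z); split.
- rewrite addnS; apply: fin_dim_adjoin => // /CD /zD /eqP.
  by rewrite ip_eq0 (negPf znz).
- by move=> x /BC; apply: sub_adjoin.
- apply/orthC/orth_adjoin; first exact: orthC.
  by move=> x /AD /zD; apply: ip0C.
Qed.

Lemma fin_dim_avoid A d x : fin_dim A d -> ~ A x -> (d < m)%N ->
  exists B, [/\ fin_dim B d.+1, A `<=` B & ~ B x].
Proof.
move=> dA nAx ltdm.
have [y nAy] := dim_gt_notin (fin_dim_adjoin dA nAx) ltdm.
have sA := fin_dim_subspace dA.
exists (adjoin A y); split; last 1 first.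
- case=> a [t [Aa xE]]; apply: nAy; have [t0|tnz] := eqVneq t 0.
    by move: nAx; rewrite xE t0 scale0r addr0.
  rewrite -[y](scalerK tnz); apply: subspaceZ; first exact: subspace_adjoin.
  have -> : t *: y = x - a by rewrite xE addrC addKr.
  apply: subspaceB; first exact: subspace_adjoin.
    exact: mem_adjoin.
  exact: sub_adjoin.
- apply: fin_dim_adjoin => // Ay; apply: nAy; exact: sub_adjoin.
- exact: sub_adjoin.
Qed.

(** Orthogonality determines inclusion.  A vector [x] of [P] outside [W] has a
   nonzero component [z] orthogonal to [W]; there is room for an [n]-dimensional
   [Q] through [z] orthogonal to [W], and [Q] is not orthogonal to [x]. *)
Lemma sub_of_orth n W k P : (0 < n)%N -> (k + n <= m.+1)%N ->
  fin_dim W k ->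
  (forall Q, fin_dim Q n -> orth Q W -> orth Q P) -> P `<=` W.
Proof.
move=> n_gt0 lekn dW QP x Px; apply: contrapT => nWx.
have [a Wa xa] := orthogonal_projection dW x.
have znz : x - a != 0.
  by rewrite subr_eq0; apply/eqP => xE; apply: nWx; rewrite xE.
have oz : orth (line (x - a)) W.
  by move=> _ y [t _ <-] Wy; rewrite ipZl xa // mulr0.
have [|Q [dQ zQ oQW]] := @fin_dim_extend_orth _ _ _ _ n.-1 dW (fin_dim_line znz) oz.
  lia.
rewrite add1n prednK // in dQ.
have := QP _ dQ oQW (x - a) x (zQ _ (mem_line _)) Px.
rewrite -[X in ip _ X](subrK a) ipDr [ip _ a]xa // addr0 => /eqP.
by rewrite ip_eq0 (negPf znz).
Qed.

End LargeDimension.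
End Orthogonality.

(** * Orthogonality preserving bijections of Grassmannians, and descent *)

Section Grassmannian.
Context {K : numFieldType} {theta : {rmorphism K -> K}}.
Context {H : completeNormedModType K}.
Variable ip : {dot H for theta}.
Implicit Types (P Q S V W : set H) (f g : set H -> set H) (d e k m n : nat).

Definition ortho_map n f : Prop :=
  (forall P, fin_dim P n -> fin_dim (f P) n) /\
  (forall P Q, fin_dim P n -> fin_dim Q n ->
     orth ip P Q -> orth ip (f P) (f Q)).

(** [f] and [g] are total maps on sets, constrained on [n]-dimensional
   subspaces only.  Preservation in both directions is expressed through the
   inverse, so that the notion is visibly symmetric in [f] and [g]. *)
Definition ortho_iso n f g : Prop :=
  [/\ ortho_map n f, ortho_map n g,
      forall P, fin_dim P n -> g (f P) = P &
      forall P, fin_dim P n -> f (g P) = P].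

Lemma ortho_iso_sym n f g : ortho_iso n f g -> ortho_iso n g f.
Proof. by case. Qed.

Lemma ortho_iso_neq n f g P Q : ortho_iso n f g -> fin_dim P n ->
  fin_dim Q n -> P <> Q -> f P <> f Q.
Proof.
by case=> _ _ gf _ dP dQ nPQ /(congr1 g); rewrite !gf.
Qed.

(** Two distinct [n]-dimensional subspaces of [W] span [W]. *)
Lemma orth_span_of_two n W P P' Q : fin_dim P n -> fin_dim P' n -> fin_dim W n.+1 ->
  P `<=` W -> P' `<=` W -> P <> P' ->
  orth ip Q P -> orth ip Q P' -> orth ip Q W.
Proof.
move=> dP dP' dW PW P'W nPP' QP QP'.
have [x P'x nPx] := fin_dim_neqP dP dP' nPP'.
rewrite (adjoin_eq dP dW PW (P'W _ P'x) nPx).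
by apply: orth_adjoin => // y Qy; apply: QP'.
Qed.

Lemma superspace_eq n W W' P P' : fin_dim P n -> fin_dim P' n ->
  fin_dim W n.+1 -> fin_dim W' n.+1 -> P <> P' ->
  P `<=` W -> P' `<=` W -> P `<=` W' -> P' `<=` W' -> W = W'.
Proof.
move=> dP dP' dW dW' nPP' PW P'W PW' P'W'.
have [x P'x nPx] := fin_dim_neqP dP dP' nPP'.
rewrite (adjoin_eq dP dW PW (P'W _ P'x) nPx).
by rewrite (adjoin_eq dP dW' PW' (P'W' _ P'x) nPx).
Qed.

Section Level.
Variables (n : nat) (f g : set H -> set H).
Hypotheses (n_gt0 : (0 < n)%N) (dimH : dim_gt H (2 * n)).
Hypothesis fg : ortho_iso n f g.

Let sub_orth W P k : fin_dim W k -> (k <= n.+1)%N ->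
  (forall Q, fin_dim Q n -> orth ip Q W -> orth ip Q P) -> P `<=` W.
Proof. by move=> dW lek; apply: (sub_of_orth dimH n_gt0) dW; lia. Qed.

(** Let [P1 <> P2] lie in [W], and let [W'] be spanned by [f P1] and a vector of
   [f P2].  An [n]-dimensional [P3'] in [W'] is [f P3] for some [P3], and what is
   orthogonal to [W] is sent to something orthogonal to [f P1] and [f P2], thus
   to [P3']; so [P3] lies in [W].  With [P3' <> f P1], the subspaces [P1] and [P3]
   span [W]; so what is orthogonal to [W'] is the image of something orthogonal
   to [W] and to every [P] in [W], which puts [f P] in [W']. *)
Lemma ortho_iso_superspace W : fin_dim W n.+1 ->
  exists W', fin_dim W' n.+1 /\ forall P, fin_dim P n -> P `<=` W -> f P `<=` W'.
Proof.
move=> dW; have [[df of_] [dg og] gf fg'] := fg.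
have [P1 [v [dP1 nP1v WE]]] := fin_dimS_adjoin dW.
have P1W : P1 `<=` W by rewrite WE; apply: sub_adjoin.
have Wv : W v by rewrite WE; apply: mem_adjoin; apply: fin_dim_subspace dP1.
have through P x : fin_dim P n -> ~ P x ->
    exists2 Q, [/\ fin_dim Q n, Q x & Q <> P] & Q `<=` adjoin P x.
  move: n_gt0; case: n => // k _ dP nPx.
  have [|Q [dQ Qx QP]] := @hyperplane_through _ _ _ _ x (fin_dim_adjoin dP nPx).
    exact/mem_adjoin/(fin_dim_subspace dP).
  by exists Q => //; split=> // QE; apply: nPx; rewrite -QE.
have [P2 [dP2 P2v nP21] P2W] := through P1 v dP1 nP1v.
rewrite -WE in P2W.
have [x fP2x nfP1x] : exists2 x, f P2 x & ~ f P1 x.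
  apply: fin_dim_neqP (df _ dP1) (df _ dP2) _.
  by apply: ortho_iso_neq fg dP1 dP2 _ => /esym.
(* At this point f P1 + f P2 may still be larger than W'. *)
pose W' := adjoin (f P1) x.
have dW' : fin_dim W' n.+1 by apply: fin_dim_adjoin => //; apply: df.
have [P3' [dP3' _ nP3'] P3'W'] := through (f P1) x (df _ dP1) nfP1x.
pose P3 := g P3'; have dP3 : fin_dim P3 n by apply: dg.
have fP3 : f P3 = P3' by apply: fg'.
have P3W : P3 `<=` W.
  apply: (sub_orth dW) => // Q dQ QW; rewrite -[Q]gf //.
  have dfQ := df _ dQ.
  apply: og => //; apply: (@orth_sub _ _ _ _ (f Q) _ W') => //.
  have fQ1 : orth ip (f Q) (f P1).
    by apply: of_ => //; apply: orth_sub QW.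
  have fQ2 : orth ip (f Q) (f P2).
    by apply: of_ => //; apply: orth_sub QW.
  by apply: orth_adjoin => // y fQy; apply: fQ2.
have nP13 : P1 <> P3 by move=> P13; apply: nP3'; rewrite -fP3 -P13.
exists W'; split=> // P dP PW.
apply: (sub_orth dW') => // Q dQ QW'; rewrite -[Q]fg' //.
have dgQ := dg _ dQ.
apply: of_ => //; apply: (@orth_sub _ _ _ _ (g Q) _ W) => //.
apply: (orth_span_of_two dP1 dP3 dW P1W P3W nP13).
  rewrite -[P1]gf //; apply: og => //; first exact: df.
  by apply: orth_sub QW' => //; apply: sub_adjoin.
by apply: og => //; apply: orth_sub QW'.
Qed.

End Level.

Lemma meet_superspace n V P Q : fin_dim V n -> fin_dim P n.+1 ->
  fin_dim Q n.+1 -> V `<=` P -> V `<=` Q -> P <> Q ->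
  exists W, [/\ fin_dim W n.+2, P `<=` W & Q `<=` W].
Proof.
move=> dV dP dQ VP VQ nPQ.
have [x Qx nPx] := fin_dim_neqP dP dQ nPQ.
exists (adjoin P x); split; [exact: fin_dim_adjoin|exact: sub_adjoin|].
rewrite (adjoin_eq dV dQ VQ Qx); last by move/VP.
by move=> y [a [t [Va ->]]]; exists a, t; split=> //; apply: VP.
Qed.

(** If [x] is in [P] and not in [Q], then [W] is spanned by [Q] and [x], and so
   [P] is spanned by [P `&` Q] and [x]. *)
Lemma superspace_meet n P Q W : fin_dim P n.+1 -> fin_dim Q n.+1 ->
  fin_dim W n.+2 -> P `<=` W -> Q `<=` W ->
  exists V, [/\ fin_dim V n, V `<=` P & V `<=` Q].
Proof.
move=> dP dQ dW PW QW.
have sP := fin_dim_subspace dP; have sQ := fin_dim_subspace dQ.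
have [->|nQP] := pselect (Q = P).
  by have [V dV VP] := hyperplane dP; exists V.
have [x Px nQx] := fin_dim_neqP dQ dP nQP.
have sPQ : subspace (P `&` Q).
  split; first by split; [case: sP|case: sQ].
  by move=> t y z [Py Qy] [Pz Qz]; split; [case: sP|case: sQ] => _; apply.
have [e _ dPQ] := subspace_fin_dim dP sPQ (@subIsetl _ _ _).
have PE : P = adjoin (P `&` Q) x.
  apply/seteqP; split; last by apply: adjoin_sub => //; apply: subIsetl.
  move=> y Py; have := PW _ Py.
  rewrite (adjoin_eq dQ dW QW (PW _ Px) nQx) => -[a [t [Qa yE]]].
  exists a, t; split=> //; split=> //.
  have -> : a = y - t *: x by rewrite yE addrK.
  by apply: subspaceB => //; apply: subspaceZ.
have dP' : fin_dim P e.+1 by rewrite PE; apply: fin_dim_adjoin => // -[].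
have le1 := fin_dim_leq dP dP' (@subset_refl _ _).
have le2 := fin_dim_leq dP' dP (@subset_refl _ _).
have <- : e = n by lia.
by exists (P `&` Q); split=> // y [].
Qed.

(** Chow's dichotomy.  The hyperplanes [V1] and [V2] of [S] either differ, and
   then they span [S] inside the span of [P] and [Q], or coincide, and then both
   equal the only hyperplane that [P] and [Q] share. *)
Lemma triple_meet n V V1 V2 P Q S : fin_dim V n -> fin_dim V1 n ->
  fin_dim V2 n -> fin_dim P n.+1 -> fin_dim Q n.+1 -> fin_dim S n.+1 ->
  P <> Q -> V `<=` P -> V `<=` Q -> V1 `<=` S -> V1 `<=` P ->
  V2 `<=` S -> V2 `<=` Q ->
  V `<=` S \/ exists W, [/\ fin_dim W n.+2, P `<=` W, Q `<=` W & S `<=` W].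
Proof.
move=> dV dV1 dV2 dP dQ dS nPQ VP VQ V1S V1P V2S V2Q.
have [V12|nV12] := pselect (V1 = V2).
  left; suff -> : V = V1 by [].
  apply: contrapT => nVV1; apply: nPQ.
  apply: (superspace_eq dV dV1 dP dQ nVV1 VP V1P VQ).
  by rewrite V12.
right; have [W [dW PW QW]] := meet_superspace dV dP dQ VP VQ nPQ.
exists W; split=> //.
have [x V2x nV1x] := fin_dim_neqP dV1 dV2 nV12.
rewrite (adjoin_eq dV1 dS V1S (V2S _ V2x) nV1x).
apply: adjoin_sub; first exact: fin_dim_subspace dW.
  by move=> y /V1P /PW.
exact/QW/V2Q.
Qed.

Section Descent.
Variables (n : nat).
Hypothesis dimH : dim_gt H (2 * n.+1).

Let adj P Q := exists W, [/\ fin_dim W n.+2, P `<=` W & Q `<=` W].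

Let adj_iso f g P Q : ortho_iso n.+1 f g -> fin_dim P n.+1 -> fin_dim Q n.+1 ->
  adj P Q -> adj (f P) (f Q).
Proof.
move=> fg dP dQ [W [dW PW QW]].
have [W' [dW' W'P]] := ortho_iso_superspace (ltn0Sn n) dimH fg dW.
by exists W'; split=> //; apply: W'P.
Qed.

Let star_adj V P Q : fin_dim V n -> fin_dim P n.+1 -> fin_dim Q n.+1 ->
  V `<=` P -> V `<=` Q -> adj P Q.
Proof.
move=> dV dP dQ VP VQ; have [->|nPQ] := pselect (P = Q); last first.
  exact: (meet_superspace dV dP dQ VP VQ nPQ).
have [|x nQx] := dim_gt_notin dimH dQ; first lia.
by exists (adjoin Q x); split; [exact: fin_dim_adjoin|exact: sub_adjoin..].
Qed.

(** The star of [V] contains three members [V + a], [V + b], [V + c] that are in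
   no common [n+2]-dimensional subspace, and the same holds for their images; so
   these share a hyperplane [V'].  If another member [P] of the star had an
   image not containing [V'], the images of [P], [V + a] and [V + b] would be in
   a common [W1], those of [P], [V + a] and [V + c] in a common [W2], and
   [W1 = W2] would contain all three. *)
Lemma ortho_iso_star f g V : ortho_iso n.+1 f g -> fin_dim V n ->
  exists V', fin_dim V' n /\ forall P, fin_dim P n.+1 -> V `<=` P -> V' `<=` f P.
Proof.
move=> fg dV; have [[df _] [dg _] gf _] := fg.
have sV := fin_dim_subspace dV.
have [|a nVa] := dim_gt_notin dimH dV; first lia.
have dVa := fin_dim_adjoin dV nVa; have sVa := fin_dim_subspace dVa.
have [|b nVab] := dim_gt_notin dimH dVa; first lia.
have dVab := fin_dim_adjoin dVa nVab; have sVab := fin_dim_subspace dVab.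
have [|c nVabc] := dim_gt_notin dimH dVab; first lia.
have nVb : ~ V b by move=> Vb; apply: nVab; apply: sub_adjoin.
have nVc : ~ V c by move=> Vc; apply: nVabc; do 2 apply: sub_adjoin.
have dVb := fin_dim_adjoin dV nVb; have dVc := fin_dim_adjoin dV nVc.
have nVaVb : adjoin V a <> adjoin V b.
  by move=> abE; apply: nVab; rewrite abE; apply: mem_adjoin.
have ncommon W : fin_dim W n.+2 -> f (adjoin V a) `<=` W ->
    f (adjoin V b) `<=` W -> f (adjoin V c) `<=` W -> False.
  move=> dW aW bW cW.
  have [W' [dW' W'P]] := ortho_iso_superspace (ltn0Sn n) dimH (ortho_iso_sym fg) dW.
  have aW' : adjoin V a `<=` W'.
    by rewrite -(gf _ dVa); apply: W'P => //; apply: df.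
  have bW' : adjoin V b `<=` W'.
    by rewrite -(gf _ dVb); apply: W'P => //; apply: df.
  have cW' : adjoin V c `<=` W'.
    by rewrite -(gf _ dVc); apply: W'P => //; apply: df.
  apply: nVabc; rewrite -(adjoin_eq dVa dW') //.
    exact/cW'/mem_adjoin.
  exact/bW'/mem_adjoin.
have meet P Q : fin_dim P n.+1 -> fin_dim Q n.+1 -> V `<=` P -> V `<=` Q ->
    exists U, [/\ fin_dim U n, U `<=` f P & U `<=` f Q].
  move=> dP dQ VP VQ.
  have [W [dW PW QW]] := adj_iso fg dP dQ (star_adj dV dP dQ VP VQ).
  by apply: superspace_meet dW PW QW; apply: df.
have [[Va Vb] Vc] := (@sub_adjoin _ _ V a, @sub_adjoin _ _ V b, @sub_adjoin _ _ V c).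
have [[dfa dfb] dfc] := (df _ dVa, df _ dVb, df _ dVc).
have nfab := ortho_iso_neq fg dVa dVb nVaVb.
have [V' [dV' V'a V'b]] := meet _ _ dVa dVb Va Vb.
have [Vac [dVac Vac_a Vac_c]] := meet _ _ dVa dVc Va Vc.
have [Vbc [dVbc Vbc_b Vbc_c]] := meet _ _ dVb dVc Vb Vc.
have V'c : V' `<=` f (adjoin V c).
  have [//|[W [dW aW bW cW]]] := triple_meet dV' dVac dVbc dfa dfb dfc nfab
    V'a V'b Vac_c Vac_a Vbc_c Vbc_b.
  by case: (ncommon W).
have nfac : f (adjoin V a) <> f (adjoin V c).
  move=> acE; have [W [dW aW bW]] := meet_superspace dV' dfa dfb V'a V'b nfab.
  by apply: (ncommon W) => //; rewrite -acE.
exists V'; split=> // P dP VP; apply: contrapT => nV'P.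
have dfP := df _ dP.
have [Ua [dUa UaP Uaa]] := meet _ _ dP dVa VP Va.
have [Ub [dUb UbP Ubb]] := meet _ _ dP dVb VP Vb.
have [Uc [dUc UcP Ucc]] := meet _ _ dP dVc VP Vc.
have [//|[W1 [dW1 aW1 bW1 PW1]]] := triple_meet dV' dUa dUb dfa dfb dfP nfab
    V'a V'b UaP Uaa UbP Ubb.
have [//|[W2 [dW2 aW2 cW2 PW2]]] := triple_meet dV' dUa dUc dfa dfc dfP nfac
    V'a V'c UaP Uaa UcP Ucc.
apply: (ncommon W1) => //; suff -> : W1 = W2 by [].
apply: (superspace_eq dfa dfP dW1 dW2 _ aW1 PW1 aW2 PW2) => aPE.
by apply: nV'P; rewrite -aPE.
Qed.

(** A subspace is the intersection of its star. *)
Lemma sub_of_star V V' : fin_dim V n -> fin_dim V' n ->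
  (forall P, fin_dim P n.+1 -> V `<=` P -> V' `<=` P) -> V' = V.
Proof.
move=> dV dV' VV'; apply: (fin_dim_sub_eq dV' dV) => x V'x.
apply: contrapT => nVx.
have [|P [dP VP nPx]] := fin_dim_avoid dimH dV nVx; first lia.
by apply: nPx; apply: VV' V'x.
Qed.

(** Two [n]-dimensional subspaces are orthogonal exactly when they are contained
   in orthogonal members of the level above, where [2n + 2 < dim H] leaves the
   necessary room. *)
Lemma ortho_iso_descent f g : ortho_iso n.+1 f g ->
  exists f' g', ortho_iso n f' g' /\
    forall V P, fin_dim V n -> fin_dim P n.+1 -> (V `<=` P <-> f' V `<=` f P).
Proof.
have star (h k : set H -> set H) : ortho_iso n.+1 h k -> exists h', forall V, fin_dim V n ->
    fin_dim (h' V) n /\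
    forall P, fin_dim P n.+1 -> V `<=` P -> h' V `<=` h P.
  move=> hk; have /choice[h' h'P] : forall V, exists V', fin_dim V n ->
      fin_dim V' n /\ forall P, fin_dim P n.+1 -> V `<=` P -> V' `<=` h P.
    move=> V; have [dV|ndV] := pselect (fin_dim V n); last by exists V.
    by have [V' V'P] := ortho_iso_star hk dV; exists V'.
  by exists h'.
move=> fg; have gf := ortho_iso_sym fg.
have [f' f'P] := star _ _ fg; have [g' g'P] := star _ _ gf.
exists f', g'.
have cancel (h k h' k' : set H -> set H) : ortho_iso n.+1 h k ->
    (forall V, fin_dim V n -> fin_dim (h' V) n /\
      forall P, fin_dim P n.+1 -> V `<=` P -> h' V `<=` h P) ->
    (forall V, fin_dim V n -> fin_dim (k' V) n /\
      forall P, fin_dim P n.+1 -> V `<=` P -> k' V `<=` k P) ->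
    forall V, fin_dim V n -> k' (h' V) = V.
  move=> [[dh _] _ kh _] h'P k'P V dV; have [dh' VP] := h'P V dV.
  have [dkh' h'VP] := k'P _ dh'.
  apply: sub_of_star => // P dP VsP; rewrite -(kh _ dP).
  by apply: h'VP; [apply: dh|apply: VP].
have orthomap (h k h' : set H -> set H) : ortho_iso n.+1 h k ->
    (forall V, fin_dim V n -> fin_dim (h' V) n /\
      forall P, fin_dim P n.+1 -> V `<=` P -> h' V `<=` h P) ->
    ortho_map n h'.
  move=> [[dh oh] _ _ _] h'P; split=> [V /h'P[]//|V W dV dW oVW].
  have [|P [dP VP oPW]] := @fin_dim_extend_orth _ _ _ _ _ dimH _ _ _ _ 1%N dW dV oVW.
    lia.
  have [|Q [dQ WQ oQP]] := @fin_dim_extend_orth _ _ _ _ _ dimH _ _ _ _ 1%N dP dW (orthC oPW).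
    lia.
  rewrite addn1 in dP dQ.
  apply: (@orth_sub _ _ _ _ (h P) _ (h Q)).
  - by apply: (h'P _ dV).2.
  - by apply: (h'P _ dW).2.
  - by apply: oh => //; apply: orthC.
have f'K := cancel _ _ _ _ fg f'P g'P; have g'K := cancel _ _ _ _ gf g'P f'P.
split; first by split=> //; [apply: orthomap fg f'P|apply: orthomap gf g'P].
move=> V P dV dP; split; first exact: (f'P _ dV).2.
have [[df _] _ gfK _] := fg.
move=> f'VP; rewrite -(f'K _ dV) -(gfK _ dP).
by apply: (g'P _ (f'P _ dV).1).2 => //; apply: df.
Qed.

End Descent.
End Grassmannian.

(** * Orthogonality preserving bijections of lines *)

Lemma rmorphism_from_fun (A B : nzRingType) (s : A -> B) :
  s 1 = 1 -> {morph s : x y / x + y} -> {morph s : x y / x * y} ->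
  exists sigma : {rmorphism A -> B}, sigma =1 s.
Proof.
move=> s1 sD sM.
have s0 : s 0 = 0 by apply: (addrI (s 0)); rewrite -sD !addr0.
have sB : zmod_morphism s.
  move=> x y; apply/(canRL (addrK _)); rewrite -sD subrK; congr (s _).
have sm : monoid_morphism s by split.
pose sa : GRing.isZmodMorphism A B s := GRing.isZmodMorphism.Build A B s sB.
pose sb : GRing.isMonoidMorphism A B s := GRing.isMonoidMorphism.Build A B s sm.
pose sigma : {rmorphism A -> B} := HB.pack s sa sb.
by exists sigma.
Qed.

Section SemiIsometry.
Context {K : numFieldType} {theta : {rmorphism K -> K}}.
Context {H : completeNormedModType K}.
Variable ip : {dot H for theta}.

(** The common generalization of unitary ([sigma = id]) and antiunitary
   ([sigma = theta]) operators, in which the scalar endomorphism is not yet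
   identified; [V] is the inverse of [U]. *)
Definition semi_isometry (sigma : {rmorphism K -> K}) (U V : H -> H) : Prop :=
  [/\ {morph U : x y / x + y}, forall t x, U (t *: x) = sigma t *: U x,
      cancel U V, cancel V U &
      forall x y, ip (U x) (U y) = sigma (ip x y)].

End SemiIsometry.

Section Lines.
Context {K : numFieldType} {H : completeNormedModType K}.
Implicit Types x y : H.

Lemma lineZ (t : K) x : t != 0 -> line (t *: x) = line x.
Proof.
move=> t0; apply/seteqP; split=> _ [s _ <-].
  by exists (s * t) => //; rewrite scalerA.
by exists (s / t) => //; rewrite scalerA divfK.
Qed.

Lemma line_eq_mem x y : x != 0 -> line y x -> line x = line y.
Proof.
move=> xnz [t _ xE]; rewrite -xE lineZ //.
by apply: contraNneq xnz => t0; rewrite -xE t0 scale0r.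
Qed.

Lemma line_eqP x y : line x = line y -> exists t, x = t *: y.
Proof. by move=> xy; have := mem_line x; rewrite xy => -[t _ <-]; exists t. Qed.

Lemma subspace_line x : subspace (line x).
Proof.
split; first by exists 0 => //; rewrite scale0r.
by move=> t _ _ [a _ <-] [b _ <-]; exists (t * a + b) => //; rewrite scalerDl scalerA.
Qed.

Lemma indep_coef x y (s t : K) : x != 0 -> ~ line x y -> s *: x = t *: y ->
  s = 0 /\ t = 0.
Proof.
move=> xnz nxy sxty; have [t0|tnz] := eqVneq t 0.
  split=> //; apply/eqP; move/eqP: sxty.
  by rewrite t0 scale0r scaler_eq0 (negPf xnz) orbF.
by case: nxy; exists (t^-1 * s) => //; rewrite -scalerA sxty scalerK.
Qed.

End Lines.

Section Charts.
Context {K : numFieldType} {theta : {rmorphism K -> K}}.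
Context {H : completeNormedModType K}.
Variable ip : {dot H for theta}.
Implicit Types (x y z : H) (f g : set H -> set H).

Lemma line_map f g x : ortho_iso ip 1 f g -> x != 0 ->
  exists2 x', x' != 0 & f (line x) = line x'.
Proof.
by move=> [[df _] _ _ _] /fin_dim_line /df /fin_dim1[x' ? ?]; exists x'.
Qed.

Lemma unit_neq0 x : ip x x = 1 -> x != 0.
Proof. by move=> x1; rewrite -(ip_eq0 ip) x1 oner_eq0. Qed.

(** The vectors orthogonal to the unit vector [e] parametrize the lines not
   orthogonal to [e], through [x |-> line (e + x)]. *)
Lemma ip_chart e x : ip e e = 1 -> ip x e = 0 -> ip (e + x) e = 1.
Proof. by move=> e1 xe; rewrite ipDl e1 xe addr0. Qed.

Lemma chart_neq0 e x : ip e e = 1 -> ip x e = 0 -> e + x != 0.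
Proof.
move=> e1 /(ip_chart e1); apply: contra_eqN => /eqP ->.
by rewrite ip0l eq_sym oner_eq0.
Qed.

Lemma chart_inj e x y : ip e e = 1 -> ip x e = 0 -> ip y e = 0 ->
  line (e + x) = line (e + y) -> x = y.
Proof.
move=> e1 xe ye /line_eqP[t exy]; apply: (addrI e).
have := ip_chart e1 xe; rewrite exy ipZl (ip_chart e1 ye) mulr1 => ->.
by rewrite scale1r.
Qed.

(** The image of a line not orthogonal to [e] is not orthogonal to [e'], as the
   inverse of [f] preserves orthogonality; rescaling brings it to the form
   [line (e' + y)]. *)
Lemma chart_image f g e e' x : ortho_iso ip 1 f g ->
  ip e e = 1 -> ip e' e' = 1 -> f (line e) = line e' -> ip x e = 0 ->
  exists2 y, ip y e' = 0 & f (line (e + x)) = line (e' + y).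
Proof.
move=> fg e1 e'1 fe xe; have [w wnz fw] := line_map fg (chart_neq0 e1 xe).
have we' : ip w e' != 0.
  apply/eqP => /orth_lines; rewrite -fw -fe.
  have [[df _] [_ og] gf _] := fg.
  have dex := fin_dim_line (chart_neq0 e1 xe).
  have de := fin_dim_line (unit_neq0 e1).
  move=> /(og _ _ (df _ dex) (df _ de)); rewrite !gf // => /orth_lines/eqP.
  by rewrite ip_chart // oner_eq0.
exists ((ip w e')^-1 *: w - e'); first by rewrite ipBl ipZl mulVf // e'1 subrr.
by rewrite [e' + _]addrC subrK lineZ ?invr_eq0.
Qed.

End Charts.

Section Base.
Context {K : numFieldType} {theta : {rmorphism K -> K}}.
Context {H : completeNormedModType K}.
Variable ip : {dot H for theta}.
Hypothesis dimH : dim_gt H 2.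
Hypothesis unit_multiple : forall x : H, x != 0 ->
  exists2 t : K, t != 0 & ip (t *: x) (t *: x) = 1.
Variables f g : set H -> set H.
Hypothesis fg : ortho_iso ip 1 f g.
Variables e e' : H.
Hypotheses (e1 : ip e e = 1) (e'1 : ip e' e' = 1) (fe : f (line e) = line e').
Implicit Types (x y z : H) (s t c : K).

(** The lines in the span of two lines are those orthogonal to all that is
   orthogonal to both, so [f] preserves collinearity. *)
Lemma collinear x y z x' y' z' : x != 0 -> y != 0 -> z != 0 ->
  adjoin (line x) y z -> f (line x) = line x' -> f (line y) = line y' ->
  f (line z) = line z' -> adjoin (line x') y' z'.
Proof.
move=> xnz ynz znz xyz fx fy fz; have [[df of_] [dg og] gf fgK] := fg.
have [[dx dy] dz] := (fin_dim_line xnz, fin_dim_line ynz, fin_dim_line znz).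
have lines_orth Q : fin_dim Q 1 -> orth ip Q (line x') -> orth ip Q (line y') ->
    orth ip Q (line z').
  move=> dQ; have dgQ := dg _ dQ; rewrite -fx -fy -fz => Qx Qy.
  rewrite -(fgK _ dQ); apply: of_ => //.
  apply: (@orth_sub _ _ _ _ (g Q) _ (adjoin (line x) y)) => //.
    move=> _ [t _ <-]; apply: subspaceZ => //.
    exact: subspace_adjoin (subspace_line _).
  have gQx : orth ip (g Q) (line x).
    by rewrite -(gf _ dx); apply: og => //; apply: df.
  have gQy : orth ip (g Q) (line y).
    by rewrite -(gf _ dy); apply: og => //; apply: df.
  by apply: orth_adjoin => // u Qu; apply: gQy => //; apply: mem_line.
have dfx := df _ dx; rewrite fx in dfx.
have closure W k : fin_dim W k -> (k <= 2)%N ->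
    (forall Q, fin_dim Q 1 -> orth ip Q W -> orth ip Q (line z')) -> W z'.
  move=> dW lek QW; apply: (sub_of_orth dimH _ _ dW QW); last exact: mem_line.
    by [].
  by rewrite addn1.
have [y'x'|ny'x'] := pselect (line x' y').
  apply: sub_adjoin; apply: closure dfx _ _ => // Q dQ Qx.
  apply: lines_orth => //; apply: (orth_sub _ _ Qx) => // _ [t _ <-].
  by apply: subspaceZ => //; apply: subspace_line.
apply: closure (fin_dim_adjoin dfx ny'x') _ _ => // Q dQ Qxy.
apply: lines_orth => //.
  by apply: orth_sub Qxy => //; apply: sub_adjoin.
apply: orth_sub Qxy => // _ [t _ <-]; apply: subspaceZ.
  exact: subspace_adjoin (subspace_line _).
exact/mem_adjoin/subspace_line.
Qed.

Lemma line_map_inj x y : x != 0 -> y != 0 -> f (line x) = f (line y) ->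
  line x = line y.
Proof.
have [_ _ gf _] := fg.
by move=> /fin_dim_line dx /fin_dim_line dy /(congr1 g); rewrite !gf.
Qed.

Section Chart.
Variable G : H -> H.
Hypothesis GP : forall x, ip x e = 0 ->
  ip (G x) e' = 0 /\ f (line (e + x)) = line (e' + G x).

Let Ge x : ip x e = 0 -> ip (G x) e' = 0. Proof. by move=> /GP[]. Qed.
Let fG x : ip x e = 0 -> f (line (e + x)) = line (e' + G x).
Proof. by move=> /GP[]. Qed.

Let perpZ t x : ip x e = 0 -> ip (t *: x) e = 0.
Proof. by move=> xe; rewrite ipZl xe mulr0. Qed.
Let perpD x y : ip x e = 0 -> ip y e = 0 -> ip (x + y) e = 0.
Proof. by move=> xe ye; rewrite ipDl xe ye addr0. Qed.

Lemma chart_map0 : G 0 = 0.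
Proof.
apply: (chart_inj e'1 (Ge (ip0l _ _)) (ip0l _ _)).
by rewrite -fG ?ip0l // !addr0 fe.
Qed.

Lemma chart_map_inj x y : ip x e = 0 -> ip y e = 0 -> G x = G y -> x = y.
Proof.
move=> xe ye Gxy; apply: (chart_inj e1 xe ye).
by apply: line_map_inj; rewrite ?(chart_neq0 e1) // !fG // Gxy.
Qed.

Lemma chart_map_surj y : ip y e' = 0 -> exists2 x, ip x e = 0 & G x = y.
Proof.
move=> ye'; have [_ _ gf fgK] := fg.
have ge' : g (line e') = line e by rewrite -fe gf //; exact/fin_dim_line/(unit_neq0 e1).
have [x xe gx] := chart_image (ortho_iso_sym fg) e'1 e1 ge' ye'.
exists x => //; apply: (chart_inj e'1 (Ge xe) ye').
by rewrite -fG // -gx fgK //; exact/fin_dim_line/(chart_neq0 e'1).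
Qed.

Lemma chart_map_neq0 x : ip x e = 0 -> x != 0 -> G x != 0.
Proof.
move=> xe; apply: contraNneq => Gx0.
by apply/eqP/(chart_map_inj xe (ip0l _ _)); rewrite chart_map0.
Qed.

(** The line of [x] is in the plane of [e] and [e + x]; its image is in the plane
   of [e'] and [e' + G x] and orthogonal to [e']. *)
Lemma line_chart_map x : ip x e = 0 -> x != 0 -> f (line x) = line (G x).
Proof.
move=> xe xnz; have [w wnz fw] := line_map fg xnz.
have we' : ip w e' = 0.
  apply/orth_lines; rewrite -fw -fe; have [[_ of_] _ _ _] := fg.
  by apply: of_; [exact: fin_dim_line|exact/fin_dim_line/(unit_neq0 e1)|exact/orth_lines].
have : adjoin (line e') (e' + G x) w.
  apply: (@collinear e (e + x) x) => //; rewrite ?(unit_neq0 e1) ?(chart_neq0 e1) //.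
  - exists (- e), 1; rewrite scale1r addKr; split=> //.
    by exists (-1) => //; rewrite scaleN1r.
  - exact: fG.
case=> _ [t [[s _ <-] wE]]; have := we'.
rewrite wE ipDl !ipZl e'1 (ip_chart e'1 (Ge xe)) !mulr1 => /eqP.
rewrite addr_eq0 => /eqP sE.
rewrite fw; apply: line_eq_mem => //; exists t => //.
by rewrite wE sE scalerDr addrA scaleNr addNr add0r.
Qed.

Lemma chart_map_indep x y : ip x e = 0 -> ip y e = 0 -> x != 0 -> ~ line y x ->
  ~ line (G y) (G x).
Proof.
move=> xe ye xnz nyx; have [->|ynz] := eqVneq y 0.
  by rewrite chart_map0 => -[t _ /eqP]; rewrite scaler0 eq_sym (negPf (chart_map_neq0 xe xnz)).
move=> /(line_eq_mem (chart_map_neq0 xe xnz)); rewrite -!line_chart_map //.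
by move=> /(line_map_inj xnz ynz) xy; apply: nyx; rewrite -xy; apply: mem_line.
Qed.

Lemma chart_map_orth x y : ip x e = 0 -> ip y e = 0 -> ip x y = 0 -> ip (G x) (G y) = 0.
Proof.
move=> xe ye xy; have [->|xnz] := eqVneq x 0; first by rewrite chart_map0 ip0l.
have [->|ynz] := eqVneq y 0; first by rewrite chart_map0 ip0r.
apply/orth_lines; rewrite -!line_chart_map //; have [[_ of_] _ _ _] := fg.
by apply: of_; [exact: fin_dim_line..|exact/orth_lines].
Qed.

(** [e + (x + y)] is in the plane of [e + x] and [y]. *)
Lemma chart_map_affine x y : ip x e = 0 -> ip y e = 0 -> y != 0 ->
  exists t, G (x + y) = G x + t *: G y.
Proof.
move=> xe ye ynz; have xye := perpD xe ye.
have : adjoin (line (e' + G x)) (G y) (e' + G (x + y)).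
  apply: (@collinear (e + x) y (e + (x + y))); rewrite ?(chart_neq0 e1) //.
  - exists (e + x), 1; rewrite scale1r addrA; split=> //; exact: mem_line.
  - exact: fG.
  - exact: line_chart_map.
  - exact: fG.
case=> _ [t [[s _ <-] GE]]; exists t.
have s1 : s = 1.
  have := congr1 (ip^~ e') GE.
  rewrite /= (ip_chart e'1 (Ge xye)) ipDl !ipZl (ip_chart e'1 (Ge xe)).
  by rewrite (Ge ye) mulr0 mulr1 addr0.
by move: GE; rewrite s1 scale1r -addrA => /addrI.
Qed.

(** Exchanging [x] and [y] in the previous lemma gives two expressions of
   [G (x + y)] on the independent vectors [G x] and [G y]. *)
Lemma chart_mapD_indep x y : ip x e = 0 -> ip y e = 0 -> x != 0 -> ~ line x y ->
  G (x + y) = G x + G y.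
Proof.
move=> xe ye xnz nxy.
have ynz : y != 0.
  by apply: contra_not_neq nxy => ->; case: (subspace_line x).
have [t tE] := chart_map_affine xe ye ynz; have [s sE] := chart_map_affine ye xe xnz.
rewrite addrC tE in sE.
have : (1 - s) *: G x = (1 - t) *: G y.
  apply/eqP; rewrite !scalerBl !scale1r subr_eq addrAC eq_sym subr_eq.
  by rewrite -sE.
move=> /(indep_coef (chart_map_neq0 xe xnz) (chart_map_indep ye xe ynz nxy))[_ /eqP].
by rewrite subr_eq0 => /eqP t1; rewrite tE -t1 scale1r.
Qed.

(** Room for [z] beside [e] and [y] is what [2 < dim H] provides. *)
Lemma perp_indep y : exists z, [/\ ip z e = 0, z != 0 & ip z y = 0].
Proof.
have de := fin_dim_line (unit_neq0 e1).
have [ye|nye] := pselect (line e y).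
  have [|z znz ze] := dim_gt_orth ip dimH de; first by [].
  by exists z; split=> //; apply: ze => //; apply: mem_line.
have [|z znz ze] := dim_gt_orth ip dimH (fin_dim_adjoin de nye); first by [].
exists z; split=> //; apply: ze; last exact/mem_adjoin/subspace_line.
exact/sub_adjoin/mem_line.
Qed.

Lemma orth_not_line y z : z != 0 -> ip z y = 0 -> ~ line y z.
Proof.
move=> znz zy [t _ zE]; have := znz.
by rewrite -(ip_eq0 ip) -[X in ip z X]zE ipZr zy mulr0 eqxx.
Qed.

(** When [y] is a multiple of [x], expand [G (x + y + z)] in two ways, with [z]
   orthogonal to [x]. *)
Lemma chart_mapD x y : ip x e = 0 -> ip y e = 0 -> G (x + y) = G x + G y.
Proof.
move=> xe ye; have [->|xnz] := eqVneq x 0; first by rewrite chart_map0 !add0r.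
have [xy|] := pselect (line x y); last exact: chart_mapD_indep.
have [z [ze znz zx]] := perp_indep x.
have nxz := orth_not_line znz zx.
have sx := subspace_line x.
have nyz : ~ line x (y + z).
  by move=> yz; apply: nxz; rewrite -[z](addKr y) addrC; apply: subspaceB.
have yze := perpD ye ze.
have := chart_mapD_indep xe yze xnz nyz.
have Gxx u : ip u e = 0 -> line x u -> G (u + z) = G u + G z.
  move=> ue xu; have [->|unz] := eqVneq u 0; first by rewrite chart_map0 !add0r.
  by apply: chart_mapD_indep => //; rewrite (line_eq_mem unz xu).
rewrite addrA !Gxx //; first by rewrite addrA => /addIr.
  exact: perpD.
by apply: subspaceD => //; apply: mem_line.
Qed.

Lemma chart_map_line t x : ip x e = 0 -> exists s, G (t *: x) = s *: G x.
Proof.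
move=> xe; have [->|xnz] := eqVneq x 0.
  by exists 0; rewrite scaler0 chart_map0 scale0r.
have [->|tnz] := eqVneq t 0; first by exists 0; rewrite !scale0r chart_map0.
have txnz : t *: x != 0 by rewrite scaler_eq0 negb_or tnz.
by apply: line_eqP; rewrite -!line_chart_map ?lineZ //; apply: perpZ.
Qed.

(** The scalar factor is read off on one vector [u]; additivity transports it
   to vectors independent of [u], and then to multiples of [u]. *)
Lemma chart_map_semilinear : exists sigma : {rmorphism K -> K},
  forall t x, ip x e = 0 -> G (t *: x) = sigma t *: G x.
Proof.
have [u [ue unz _]] := perp_indep e.
have /choice[s sP] : forall t, exists s, G (t *: u) = s *: G u.
  by move=> t; apply: chart_map_line.
have indep t x : ip x e = 0 -> x != 0 -> ~ line u x -> G (t *: x) = s t *: G x.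
  move=> xe xnz nux; have [r rE] := chart_map_line t xe.
  have [q qE] := chart_map_line t (perpD ue xe).
  have E : s t *: G u + r *: G x = q *: G u + q *: G x.
    by rewrite -sP -rE -chart_mapD ?perpZ // -scalerDr qE chart_mapD // scalerDr.
  have : (s t - q) *: G u = (q - r) *: G x.
    apply/eqP; rewrite !scalerBl subr_eq addrAC eq_sym subr_eq.
    by rewrite E addrC.
  move=> /(indep_coef (chart_map_neq0 ue unz) (chart_map_indep xe ue xnz nux))[/eqP].
  rewrite subr_eq0 => /eqP stq /eqP; rewrite subr_eq0 => /eqP qr.
  by rewrite rE stq qr.
have Gs t x : ip x e = 0 -> G (t *: x) = s t *: G x.
  move=> xe; have [->|xnz] := eqVneq x 0; first by rewrite scaler0 chart_map0 scaler0.
  have [ux|nux] := pselect (line u x); last exact: indep.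
  have [z [ze znz zu]] := perp_indep u.
  have nuz := orth_not_line znz zu.
  have nuxz : ~ line u (x + z).
    move=> xz; apply: nuz; rewrite -[z](addKr x) addrC.
    by apply: subspaceB => //; apply: subspace_line.
  have xznz : x + z != 0.
    by apply: contra_not_neq nuxz => ->; case: (subspace_line u).
  have := indep t _ (perpD xe ze) xznz nuxz.
  rewrite scalerDr !chart_mapD ?perpZ // (indep t z) // scalerDr.
  exact: addIr.
have inj a b : a *: G u = b *: G u -> a = b.
  move=> /eqP; rewrite -subr_eq0 -scalerBl scaler_eq0 (negPf (chart_map_neq0 ue unz)).
  by rewrite orbF subr_eq0 => /eqP.
have [||| sigma sigmaE] := @rmorphism_from_fun _ _ s.
- by apply: inj; rewrite -sP !scale1r.
- move=> a b; apply: inj; rewrite -sP !scalerDl -!sP.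
  by apply: chart_mapD; apply: perpZ.
- by move=> a b; apply: inj; rewrite -sP -!scalerA -sP -Gs //; apply: perpZ.
by exists sigma => t x xe; rewrite sigmaE; apply: Gs.
Qed.

Section Scalars.
Variable sigma : {rmorphism K -> K}.
Hypothesis GZ : forall t x, ip x e = 0 -> G (t *: x) = sigma t *: G x.

(** If [<x, y> <> 0] and [t = - <x, y>^-1], the vectors [e + t x] and [e + y] are orthogonal, and
   the orthogonality of [e' + sigma t G x] and [e' + G y] is the claim. *)
Lemma chart_map_ip x y : ip x e = 0 -> ip y e = 0 -> ip (G x) (G y) = sigma (ip x y).
Proof.
move=> xe ye; have [xy|xynz] := eqVneq (ip x y) 0.
  by rewrite xy rmorph0; apply: chart_map_orth.
pose t := - (ip x y)^-1; have txe := perpZ t xe.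
have [[_ of_] _ _ _] := fg.
have : ip (e' + G (t *: x)) (e' + G y) = 0.
  apply/orth_lines; rewrite -!fG //.
  apply: of_; try exact/fin_dim_line/(chart_neq0 e1).
  apply/orth_lines; rewrite ipDr ip_chart // ipDl (ip0C ye) add0r.
  by rewrite ipZl mulNr mulVf // subrr.
rewrite ipDr (ip_chart e'1 (Ge txe)) ipDl (ip0C (Ge ye)) add0r GZ // ipZl.
rewrite rmorphN mulNr fmorphV => /eqP; rewrite subr_eq0 => /eqP /esym ss.
have snz : sigma (ip x y) != 0 by rewrite fmorph_eq0.
by apply: (mulfI (_ : (sigma (ip x y))^-1 != 0)); rewrite ?invr_eq0 // mulVf.
Qed.

(** Compare the products of [v] and [t v] for a unit vector [v]. *)
Lemma chart_scalar_theta t : sigma (theta t) = theta (sigma t).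
Proof.
have [u [ue unz _]] := perp_indep e; have [a anz u1] := unit_multiple unz.
set v := a *: u in u1; have ve : ip v e = 0 by apply: perpZ.
have := chart_map_ip ve (perpZ t ve); rewrite ipZr GZ // ipZr chart_map_ip // u1.
by rewrite rmorph1 !mulr1.
Qed.

(** The line of [G u] is the image of the line of [u]. *)
Lemma chart_scalar_surj s : exists t, sigma t = s.
Proof.
have [->|snz] := eqVneq s 0; first by exists 0; rewrite rmorph0.
have [u [ue unz _]] := perp_indep e.
have Gunz := chart_map_neq0 ue unz.
have [|x xe Gx] := @chart_map_surj (s *: G u); first by rewrite ipZl Ge // mulr0.
have xnz : x != 0.
  apply: contraTneq (snz) => x0; have := Gx; rewrite x0 chart_map0 => /esym/eqP.
  by rewrite scaler_eq0 (negPf Gunz) orbF negbK.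
have /line_eqP[t xE] : line x = line u.
  by apply: line_map_inj => //; rewrite !line_chart_map // Gx lineZ.
exists t; move: Gx; rewrite xE GZ // => /eqP.
by rewrite -subr_eq0 -scalerBl scaler_eq0 (negPf Gunz) orbF subr_eq0 => /eqP.
Qed.

Let perp x := x - ip x e *: e.

Let perpP x : ip (perp x) e = 0.
Proof. by rewrite ipBl ipZl e1 mulr1 subrr. Qed.

(* The coordinate along e is transported by sigma, the rest by the chart. *)
Let U x := sigma (ip x e) *: e' + G (perp x).

Lemma chart_semi_isometry : exists V, semi_isometry ip sigma U V /\
  forall P, fin_dim P 1 -> f P = U @` P.
Proof.
have UD : {morph U : x y / x + y}.
  move=> x y; rewrite /U ipDl rmorphD scalerDl addrACA -chart_mapD ?perpP //.
  by rewrite /perp ipDl scalerDl opprD addrACA.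
have UZ t x : U (t *: x) = sigma t *: U x.
  rewrite /U scalerDr scalerA -rmorphM -GZ ?perpP // /perp ipZl.
  by rewrite scalerBr scalerA.
have Uip x y : ip (U x) (U y) = sigma (ip x y).
  rewrite /U ipDl !ipDr !ipZl !ipZr e'1 (Ge (perpP _)) (ip0C (Ge (perpP _))).
  rewrite chart_map_ip ?perpP // !mulr0 mulr1 addr0 add0r -chart_scalar_theta -rmorphM -rmorphD.
  congr (sigma _); rewrite /perp ipBl !ipBr !ipZl !ipZr e1 [ip e y]ipC.
  by rewrite mulr1 subrr subr0 [theta _ * _]mulrC addrC subrK.
have Uperp x : ip x e = 0 -> U x = G x.
  by move=> xe; rewrite /U /perp xe rmorph0 !scale0r subr0 add0r.
have /choice[V VK] : forall y, exists x, U x = y.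
  move=> y; have [t tE] := chart_scalar_surj (ip y e').
  have [|x xe Gx] := @chart_map_surj (y - ip y e' *: e').
    by rewrite ipBl ipZl e'1 mulr1 subrr.
  exists (t *: e + x); rewrite UD UZ (Uperp x) // Gx.
  rewrite /U /perp e1 rmorph1 !scale1r subrr chart_map0 addr0 tE.
  by rewrite addrC subrK.
have Uinj x y : U x = U y -> x = y.
  move=> Uxy; apply/eqP; rewrite -subr_eq0 -(ip_eq0 ip) -(fmorph_eq0 sigma) -Uip.
  by rewrite UD Uxy -UD subrr -(scale0r 0) UZ rmorph0 scale0r ip0l.
exists V; split; first by split=> // x; apply: Uinj; rewrite VK.
move=> _ /fin_dim1[v vnz ->].
have -> : U @` line v = line (U v).
  apply/seteqP; split=> [_ [_ [t _ <-] <-]|_ [s _ <-]].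
    by exists (sigma t) => //; rewrite UZ.
  by have [t <-] := chart_scalar_surj s; exists (t *: v); [exists t|rewrite UZ].
have [ve|venz] := eqVneq (ip v e) 0; first by rewrite Uperp // line_chart_map.
have tnz : (ip v e)^-1 != 0 by rewrite invr_eq0.
have vE : (ip v e)^-1 *: v = e + (ip v e)^-1 *: perp v.
  by rewrite scalerBr scalerA mulVf // scale1r addrC subrK.
rewrite -(lineZ v tnz) vE fG ?GZ ?perpZ //.
have stnz : sigma (ip v e)^-1 != 0 by rewrite fmorph_eq0.
rewrite -(lineZ (U v) stnz) /U scalerDr scalerA -rmorphM mulVf // rmorph1.
by rewrite scale1r.
Qed.

End Scalars.
End Chart.
End Base.

Section Uhlhorn.
Context {K : numFieldType} {theta : {rmorphism K -> K}}.
Context {H : completeNormedModType K}.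
Variable ip : {dot H for theta}.
Hypothesis unit_multiple : forall x : H, x != 0 ->
  exists2 t : K, t != 0 & ip (t *: x) (t *: x) = 1.

Lemma ortho_iso_lines f g : dim_gt H 2 -> ortho_iso ip 1 f g ->
  exists (sigma : {rmorphism K -> K}) U V,
    [/\ semi_isometry ip sigma U V, forall t, sigma (theta t) = theta (sigma t) &
        forall P, fin_dim P 1 -> f P = U @` P].
Proof.
move=> dimH fg.
have d0 : fin_dim [set (0 : H)] 0 by apply/fin_dim0.
have [v nv] := dim_gt_notin dimH d0 isT.
have vnz : v != 0 by apply/eqP.
have [a anz e1] := unit_multiple vnz; set e := a *: v in e1.
have [w wnz fe] := line_map fg (unit_neq0 e1).
have [b bnz e'1] := unit_multiple wnz; rewrite -(lineZ w bnz) in fe.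
set e' := b *: w in e'1 fe.
have /choice[G GP] : forall x, exists y, ip x e = 0 ->
    ip y e' = 0 /\ f (line (e + x)) = line (e' + y).
  move=> x; have [xe|xe] := eqVneq (ip x e) 0.
    by have [y ye' fy] := chart_image fg e1 e'1 fe xe; exists y.
  by exists 0 => xe0; rewrite xe0 eqxx in xe.
have [sigma GZ] := chart_map_semilinear dimH fg e1 e'1 fe GP.
have [V [UV fU]] := chart_semi_isometry dimH unit_multiple fg e1 e'1 fe GP GZ.
exists sigma; eexists; exists V; split; [exact: UV| |exact: fU].
exact: (chart_scalar_theta dimH unit_multiple fg e1 e'1 fe GP GZ).
Qed.

(** Induction on the rank.  Every vector of [P] is in a hyperplane of [P] on
   which the induced map is already known to act by [U]. *)
Theorem ortho_iso_semi_isometry n f g : (0 < n)%N -> dim_gt H (2 * n) ->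
  ortho_iso ip n f g ->
  exists (sigma : {rmorphism K -> K}) U V,
    [/\ semi_isometry ip sigma U V, forall t, sigma (theta t) = theta (sigma t) &
        forall P, fin_dim P n -> f P = U @` P].
Proof.
case: n => // n _; elim: n f g => [|n IH] f g dimH fg.
  exact: ortho_iso_lines fg.
have [f' [g' [fg' f'f]]] := ortho_iso_descent dimH fg.
have dimH' : dim_gt H (2 * n.+1) by move=> d /dimH; lia.
have [sigma [U [V [UV st f'U]]]] := IH _ _ dimH' fg'.
have [[df' _] [dg' _] gf' fgK'] := fg'.
have [[df _] _ _ _] := fg.
exists sigma, U, V; split=> // P dP.
apply/seteqP; split=> [y fPy|_ [x Px <-]].
  have [S [dS Sy SfP]] := hyperplane_through (df _ dP) fPy.
  have dgS := dg' _ dS; rewrite -(fgK' _ dS) f'U // in Sy SfP.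
  have [x gSx <-] := Sy; exists x => //.
  by move: x gSx {Sy}; apply/(f'f _ _ dgS dP); rewrite f'U.
have [S [dS Sx SP]] := hyperplane_through dP Px.
have /(f'f _ _ dS dP) := SP; apply.
by rewrite f'U //; exists x.
Qed.

End Uhlhorn.

(** * Endomorphisms of the scalars *)

(** Squares go to squares, so [sigma] is monotone; it fixes the rationals, which
   are dense. *)
Lemma real_rmorphism_id (R : realType) (sigma : {rmorphism R -> R}) : sigma =1 id.
Proof.
have sigma_ge0 x : 0 <= x -> 0 <= sigma x.
  by move=> /sqr_sqrtr <-; rewrite rmorphXn sqr_ge0.
have sigma_le x y : x <= y -> sigma x <= sigma y.
  by rewrite -subr_ge0 => /sigma_ge0; rewrite rmorphB subr_ge0.
move=> x; apply/eqP; rewrite eq_le; apply/andP; split; rewrite leNgt; apply/negP.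
- move=> /rat_in_itvoo[q]; rewrite in_itv /= => /andP[/ltW/sigma_le + ltq].
  by rewrite fmorph_rat leNgt ltq.
- move=> /rat_in_itvoo[q]; rewrite in_itv /= => /andP[ltq /ltW/sigma_le].
  by rewrite fmorph_rat leNgt ltq.
Qed.

(** The reals are the fixed points of the conjugation, so they are preserved,
   hence fixed; and a square root of -1 goes to a square root of -1. *)
Lemma complex_rmorphism (R : realType) (sigma : {rmorphism R[i] -> R[i]}) :
  (forall z, sigma (Num.conj z) = Num.conj (sigma z)) ->
  sigma =1 id \/ sigma =1 Num.conj.
Proof.
move=> sJ.
have sR (x : R) : sigma (x%:C)%C = (complex.Re (sigma (x%:C)%C))%:C%C.
  apply/esym/RRe_real/CrealP; rewrite -sJ; congr (sigma _).
  by apply/CrealP/complex_realP; exists x.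
pose s (x : R) := complex.Re (sigma (x%:C)%C).
have [||| tau tauE] := @rmorphism_from_fun R R s.
- by rewrite /s rmorph1.
- move=> x y; have -> : s (x + y) = complex.Re (sigma (x%:C + y%:C)%C).
    by congr (complex.Re (sigma _)); apply/eqP; rewrite eq_complex /= addr0 !eqxx.
  by rewrite rmorphD sR [sigma (y%:C)%C]sR.
- move=> x y; have -> : s (x * y) = complex.Re (sigma (x%:C * y%:C)%C).
    congr (complex.Re (sigma _)); apply/eqP; rewrite eq_complex /=.
    by rewrite !(mulr0, mul0r, addr0, subr0) !eqxx.
  by rewrite rmorphM sR [sigma (y%:C)%C]sR /= mulr0 subr0.
have {}sR (x : R) : sigma (x%:C)%C = (x%:C)%C.
  by rewrite sR -/(s x) -tauE real_rmorphism_id.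
have : sigma 'i%C ^+ 2 = 'i%C ^+ 2.
  by rewrite -rmorphXn /= sqr_i rmorphN rmorph1.
move/eqP; rewrite eqf_sqr => /orP[] /eqP si; [left|right] => z.
  by rewrite (complexE z) rmorphD rmorphM !sR si.
rewrite {1}(complexE z) rmorphD rmorphM !sR si.
have -> : Num.conj z = conjc z by [].
case: z => a b; apply/eqP; rewrite eq_complex /=.
by rewrite !(mulr0, mul0r, addr0, add0r, subr0, oppr0, mulN1r) !eqxx.
Qed.

(** * Projections and their ranges *)

Section Projections.
Context {K : numFieldType} {theta : {rmorphism K -> K}}.
Context {H : completeNormedModType K}.
Variable ip : {dot H for theta}.
Hypothesis norm_ip : norm_from_dot ip.

Lemma fixed_range (P : H -> H) x : idempotent_fun P -> range P x -> P x = x.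
Proof. by move=> PP [y _ <-]; apply: PP. Qed.

(** For [y] in the common range, both [<P x, y>] and [<Q x, y>] are [<x, y>]. *)
Lemma proj_eq_range (P Q : H -> H) : self_adjoint ip P -> self_adjoint ip Q ->
  idempotent_fun P -> idempotent_fun Q -> range P = range Q -> P = Q.
Proof.
move=> sP sQ PP QQ PQ; apply/funext => x.
have ipP y : range P y -> ip (P x) y = ip x y.
  by move=> Py; rewrite sP (fixed_range PP).
have ipQ y : range P y -> ip (Q x) y = ip x y.
  by rewrite PQ => Qy; rewrite sQ (fixed_range QQ).
have Px : range P (P x) by exists x.
have Qx : range P (Q x) by rewrite PQ; exists x.
apply/eqP; rewrite -subr_eq0 -(ip_eq0 ip) ipBl !ipBr.
by rewrite !ipP // !ipQ // subrr.
Qed.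

Lemma norm_eq x y : ip x x = ip y y -> `|x| = `|y|.
Proof.
rewrite -!norm_ip => xy; apply/eqP.
by rewrite -(@eqrXn2 _ 2) ?normr_ge0 // xy eqxx.
Qed.

(** The orthogonal decomposition of every vector along [A] is unique, which gives
   linearity; the norm bound 1 is Pythagoras' theorem. *)
Lemma range_rank_proj n (A : set H) : fin_dim A n ->
  exists P : rank_proj ip n, range (val P) = A.
Proof.
move=> dA; have sA := fin_dim_subspace dA.
have /choice[P PP] : forall x, exists a, A a /\ forall y, A y -> ip (x - a) y = 0.
  by move=> x; have [a] := orthogonal_projection ip dA x; exists a.
have PA x : A (P x) by case: (PP x).
have uniq x a : A a -> (forall y, A y -> ip (x - a) y = 0) -> P x = a.
  move=> Aa xa; apply/eqP; rewrite -subr_eq0 -(ip_eq0 ip).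
  have AB : A (P x - a) by apply: subspaceB.
  have {1}-> : P x - a = (x - a) - (x - P x).
    by rewrite opprB addrC [RHS]addrC addrA subrK addrC.
  by rewrite ipBl xa // (PP x).2 // subrr.
have linP : linear P.
  move=> t x y; apply: uniq => [|z Az].
    by apply: subspaceD => //; apply: subspaceZ.
  by rewrite opprD addrACA -scalerBr ipDl ipZl (PP x).2 // (PP y).2 // mulr0 addr0.
have PPP x y : ip (P x) y = ip (P x) (P y).
  apply/eqP; rewrite -subr_eq0 -ipBr; apply/eqP/ip0C.
  exact: (PP y).2.
have selfP : self_adjoint ip P.
  by move=> x y; rewrite PPP ipC -PPP -ipC.
have idemP : idempotent_fun P.
  by move=> x; apply: uniq => // y _; rewrite subrr ip0l.
have boundP : bounded_op P.
  exists 1 => x; rewrite mul1r -(@ler_pXn2r _ 2) ?nnegrE ?normr_ge0 //.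
  have -> : `|x| ^+ 2 = `|P x| ^+ 2 + `|x - P x| ^+ 2.
    rewrite !norm_ip; have := (PP x).2 _ (PA x); move: (x - P x) (subrK (P x) x).
    move=> w wE wP; rewrite -{1 2}wE ipDl !ipDr wP (ip0C wP).
    by rewrite addr0 add0r addrC.
  by rewrite lerDl exprn_ge0 ?normr_ge0.
have ranP : range P = A.
  apply/seteqP; split=> [_ [x _ <-]//|x Ax]; exists x => //.
  by apply: uniq => // y _; rewrite subrr ip0l.
have memP : P \in rank_proj ip n by rewrite inE; split=> //; rewrite ranP.
by exists (SigSub memP).
Qed.

Lemma rank_projP n (P : rank_proj ip n) :
  [/\ linear (val P), bounded_op (val P), self_adjoint ip (val P),
      idempotent_fun (val P) & fin_dim (range (val P)) n].
Proof. by have := valP P; rewrite inE. Qed.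

Lemma rank_proj_inj n (P Q : rank_proj ip n) : range (val P) = range (val Q) ->
  P = Q.
Proof.
have [_ _ sP iP _] := rank_projP P; have [_ _ sQ iQ _] := rank_projP Q.
by move=> /(proj_eq_range sP sQ iP iQ) /val_inj.
Qed.

Lemma proj_orthogonalP n (P Q : rank_proj ip n) :
  proj_orthogonal P Q <-> orth ip (range (val P)) (range (val Q)).
Proof.
have [_ _ sP iP _] := rank_projP P.
split=> [PQ _ _ [x _ <-] [y _ <-]|PQ].
  rewrite sP; have -> : val P (val Q y) = 0 by apply: (congr1 (@^~ y) PQ).
  exact: ip0r.
apply/funext => x /=; apply/eqP; rewrite -(ip_eq0 ip) sP; apply/eqP/ip0C.
by apply: PQ; [exists (val P (val Q x))|exists x].
Qed.

Section Transfer.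
Variable n : nat.
Hypotheses (n_gt0 : (0 < n)%N) (dimH : dim_gt H (2 * n)).
Variable phi : rank_proj ip n -> rank_proj ip n.
Hypothesis phi_surj : set_surj [set: rank_proj ip n] [set: rank_proj ip n] phi.
Hypothesis phi_orth : preserves_orthogonality phi.

Lemma fin_dim_range (P : rank_proj ip n) : fin_dim (range (val P)) n.
Proof. by have [] := rank_projP P. Qed.

(** The range of [P] is determined by the projections orthogonal to [P], which
   is where both directions of preservation are used. *)
Lemma preserves_orthogonality_inj P Q : phi P = phi Q -> P = Q.
Proof.
move=> PQ; have sub (A B : rank_proj ip n) : phi A = phi B ->
    range (val A) `<=` range (val B).
  move=> AB; apply: (sub_of_orth dimH n_gt0 _ (fin_dim_range B)); first lia.
  move=> C dC; have [R <-] := range_rank_proj dC.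
  by move=> /proj_orthogonalP/phi_orth; rewrite -AB => RA; apply/proj_orthogonalP/phi_orth.
by apply: rank_proj_inj; apply/seteqP; split; apply: sub.
Qed.

Lemma ortho_iso_of_projections : exists f g, ortho_iso ip n f g /\
  forall P, f (range (val P)) = range (val (phi P)).
Proof.
(* A default value for sets that are not the range of a rank n projection. *)
have [P0 _] : exists P : rank_proj ip n, True.
  have d0 : fin_dim [set (0 : H)] 0 by apply/fin_dim0.
  have [||C [dC _ _]] := fin_dim_extend_orth (k := n) (ip := ip) dimH d0 d0.
  - by move=> _ _ -> ->; rewrite ip0l.
  - lia.
  - by have [P _] := range_rank_proj dC; exists P.
have /choice[pr prP] : forall A, exists P : rank_proj ip n,
    fin_dim A n -> range (val P) = A.
  move=> A; have [dA|ndA] := pselect (fin_dim A n).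
    by have [P PA] := range_rank_proj dA; exists P.
  by exists P0.
have prK P : pr (range (val P)) = P.
  by apply: rank_proj_inj; apply: prP; apply: fin_dim_range.
have /choice[psi psiK] : forall P, exists Q, phi Q = P.
  by move=> P; have /phi_surj[Q _ QP] : [set: rank_proj ip n] P by []; exists Q.
exists (fun A => range (val (phi (pr A)))), (fun A => range (val (psi (pr A)))).
split; last by move=> P; rewrite prK.
split.
- split=> [A _|A B dA dB]; first exact: fin_dim_range.
  rewrite -{1}(prP A dA) -{1}(prP B dB) => /proj_orthogonalP/phi_orth.
  by move=> /proj_orthogonalP.
- split=> [A _|A B dA dB]; first exact: fin_dim_range.
  rewrite -{1}(prP A dA) -{1}(prP B dB) => /proj_orthogonalP AB.
  by apply/proj_orthogonalP/phi_orth; rewrite !psiK.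
- move=> A dA; rewrite prK -[RHS](prP A dA).
  suff -> : psi (phi (pr A)) = pr A by [].
  by apply: preserves_orthogonality_inj; rewrite psiK.
- by move=> A dA; rewrite prK psiK prP.
Qed.

(** [U P V] is again a self-adjoint idempotent, with range the image under [U] of
   the range of [P]. *)
Lemma conj_semi_isometry sigma U V P : semi_isometry ip sigma U V ->
  range (val (phi P)) = U @` range (val P) -> val (phi P) = U \o val P \o V.
Proof.
move=> [UD UZ UK VK Uip] phiP.
have [_ _ sP iP _] := rank_projP P; have [_ _ sphi iphi _] := rank_projP (phi P).
apply: proj_eq_range => //.
- by move=> x y /=; rewrite -{1}(VK y) Uip sP -Uip VK.
- by move=> x /=; rewrite UK; congr U; apply: iP.
rewrite phiP; apply/seteqP; split=> [_ [_ [x _ <-] <-]|_ [x _ <-]].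
  by exists (U x) => //=; rewrite UK.
by exists (val P (V x)) => //; exists (V x).
Qed.

End Transfer.
End Projections.

(** * Unitary and antiunitary operators *)

Section Main.
Context {K : numFieldType} {theta : {rmorphism K -> K}}.
Context {H : completeNormedModType K}.
Variable ip : {dot H for theta}.
Hypothesis norm_ip : norm_from_dot ip.
Hypothesis theta_ge0 : forall t : K, 0 <= t -> theta t = t.

(** The norm provides the square root of [<x, x>] among the scalars, and
   [theta] fixes it because it is nonnegative. *)
Lemma unit_multiple (x : H) : x != 0 ->
  exists2 t : K, t != 0 & ip (t *: x) (t *: x) = 1.
Proof.
move=> xnz; have nx : `|x| != 0 by rewrite normr_eq0.
exists `|x|^-1; first by rewrite invr_eq0.
by rewrite ipZl ipZr theta_ge0 ?invr_ge0 // -norm_ip expr2 mulKf // mulVf.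
Qed.

Lemma ip_ge0 (x : H) : 0 <= ip x x.
Proof. by rewrite -norm_ip exprn_ge0. Qed.

Lemma projections_semi_isometry n (phi : rank_proj ip n -> rank_proj ip n) :
  (0 < n)%N -> dim_gt H (2 * n) ->
  set_surj [set: rank_proj ip n] [set: rank_proj ip n] phi ->
  preserves_orthogonality phi ->
  exists (sigma : {rmorphism K -> K}) U V,
    [/\ semi_isometry ip sigma U V, forall t, sigma (theta t) = theta (sigma t) &
        forall P, val (phi P) = U \o val P \o V].
Proof.
move=> n_gt0 dimH phi_surj phi_orth.
have [f [g [fg fphi]]] := ortho_iso_of_projections norm_ip n_gt0 dimH phi_surj phi_orth.
have [sigma [U [V [UV st fU]]]] := ortho_iso_semi_isometry unit_multiple n_gt0 dimH fg.
exists sigma, U, V; split=> // P; apply: (conj_semi_isometry UV).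
by rewrite -fphi fU //; apply: fin_dim_range.
Qed.

Lemma semi_isometry_norm (sigma : {rmorphism K -> K}) U V :
  (forall t, 0 <= t -> sigma t = t) -> semi_isometry ip sigma U V ->
  forall x, `|U x| = `|x|.
Proof.
move=> sigma_ge0 [_ _ _ _ Uip] x; apply: (norm_eq norm_ip).
by rewrite Uip sigma_ge0 // ip_ge0.
Qed.

Lemma semi_isometry_unitary (sigma : {rmorphism K -> K}) U V :
  sigma =1 id -> semi_isometry ip sigma U V ->
  unitary_op U /\ adjoint_op ip U V.
Proof.
move=> s1 UV; have [UD UZ UK VK Uip] := UV; split.
  split; last by apply: semi_isometry_norm UV => t _; rewrite s1.
    by move=> t x y; rewrite UD UZ s1.
  by exists V.
by move=> x y; rewrite -{1}(VK y) Uip s1.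
Qed.

Lemma semi_isometry_antiunitary (sigma : {rmorphism K -> K}) U V :
  sigma =1 theta -> semi_isometry ip sigma U V ->
  antiunitary_op theta U /\ antiadjoint_op ip U V.
Proof.
move=> s1 UV; have [UD UZ UK VK Uip] := UV; split.
  split; last by apply: semi_isometry_norm UV => t t0; rewrite s1 theta_ge0.
    by move=> t x y; rewrite UD UZ s1.
  by exists V.
by move=> x y; rewrite -{1}(VK y) Uip s1.
Qed.

End Main.

Theorem theorem1p2 (R : realType) (n : nat) (n_gt0 : (0 < n)%N) :
  (forall (H : completeNormedModType R[i])
      (ip : {dot H for (Num.conj : R[i] -> R[i])})
      (phi : rank_proj ip n -> rank_proj ip n),
    norm_from_dot ip ->
    dim_gt H (2 * n) ->
    set_surj [set: rank_proj ip n] [set: rank_proj ip n] phi ->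
    preserves_orthogonality phi ->
    exists U V : H -> H,
      (unitary_op U /\ adjoint_op ip U V \/
       antiunitary_op (Num.conj : R[i] -> R[i]) U /\ antiadjoint_op ip U V) /\
      forall P : rank_proj ip n, val (phi P) = U \o val P \o V)
  /\
  (forall (H : completeNormedModType R)
      (ip : {dot H for (idfun : R -> R)})
      (phi : rank_proj ip n -> rank_proj ip n),
    norm_from_dot ip ->
    dim_gt H (2 * n) ->
    set_surj [set: rank_proj ip n] [set: rank_proj ip n] phi ->
    preserves_orthogonality phi ->
    exists U V : H -> H,
      (unitary_op U /\ adjoint_op ip U V) /\
      forall P : rank_proj ip n, val (phi P) = U \o val P \o V).
Proof.
split=> H ip phi norm_ip dimH phi_surj phi_orth.
- have conj_ge0 (t : R[i]) : 0 <= t -> Num.conj t = t by exact: geC0_conj.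
  have [sigma [U [V [UV sJ phiE]]]] :=
    projections_semi_isometry norm_ip conj_ge0 n_gt0 dimH phi_surj phi_orth.
  exists U, V; split=> //; have [s1|s1] := complex_rmorphism sJ; [left|right].
    exact: semi_isometry_unitary UV.
  exact: semi_isometry_antiunitary UV.
- have id_ge0 (t : R) : 0 <= t -> (idfun : {rmorphism R -> R}) t = t by [].
  have [sigma [U [V [UV _ phiE]]]] :=
    projections_semi_isometry norm_ip id_ge0 n_gt0 dimH phi_surj phi_orth.
  exists U, V; split=> //.
  by apply: semi_isometry_unitary UV => //; apply: real_rmorphism_id.
Qed.
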